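(* Let $M=(X,d_M)$ be a finite metric space satisfying the tie-breaking rule. Then $M$ is a spanning tree metric space if and only if $M$ satisfies the fourth-point condition.
   Context: A finite metric space $(X,d_M)$ satisfies the tie-breaking rule if the values $d_M(x,x')$ are pairwise distinct over all unordered pairs $\{x,x'\}$ of distinct points of $X$. It satisfies the fourth-point condition if for every (not necessarily distinct) $x,y,z\in X$ there is a point $p^*\in X$ with $d_M(x,p^* )+d_M(y,p^* )+d_M(z,p^* )=\tfrac12\{d_M(x,y)+d_M(y,z)+d_M(z,x)\}$. Let $K_M$ be the complete graph on vertex set $X$ in which the edge $e(x,x')$ joining distinct $x,x'$ has weight $d_M(x,x')$. An edge $e(x,x')$ of $K_M$ is non-basic if there exist $k\ge 1$ and distinct points $x_1,\dots,x_k\in X\setminus\{x,x'\}$ with $d_M(x,x')=d_M(x,x_1)+d_M(x_1,x_2)+\cdots+d_M(x_{k-1},x_k)+d_M(x_k,x')$; otherwise it is basic. The basic geodesic graph $G_M$ is the subgraph of $K_M$ with vertex set $X$, edge set the set of all basic edges, and weights given by $d_M$. $M$ is a spanning tree metric space if $G_M$ is a spanning tree of $K_M$. *)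

(* Defs.v *)
From HB Require Import structures.
From mathcomp Require Import all_boot all_order all_algebra.
From mathcomp Require Import boolp filter reals topology.

Set Implicit Arguments.
Unset Strict Implicit.
Unset Printing Implicit Defensive.

Import Order.TTheory GRing.Theory Num.Theory.

Local Open Scope ring_scope.

#[short(type="finMetricType")]
HB.structure Definition FinMetric (R : realType) :=
  { X of Finite X & Metric R X }.

(* All graphs on V considered here have the whole of V as vertex set.
   The values of [weight] are only meaningful on edges. *)
Record wgraph (R : realType) (V : finType) := WGraph {
  edge : rel V;
  weight : V -> V -> R;
  edge_sym : symmetric edge;
  edge_irrefl : irreflexive edge;
  weight_sym : forall x y, weight x y = weight y x
}.

Section Graphs.
Context {R : realType} {V : finType}.
Implicit Types G H : wgraph R V.

Definition spanning_subgraph H G : Prop :=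
  forall x y, edge H x y -> edge G x y /\ weight H x y = weight G x y.

Definition connected_graph G : Prop := forall x y, connect (edge G) x y.

(* [ucycle] also accepts the sequence [:: x; y] for an edge xy, whence the
   bound on the length. *)
Definition acyclic_graph G : Prop :=
  forall c : seq V, (2 < size c)%N -> ~ ucycle (edge G) c.

(* The graph without vertices counts as a tree, so that the empty metric space
   needs no separate treatment. *)
Definition tree G : Prop := connected_graph G /\ acyclic_graph G.

Definition spanning_tree T G : Prop := spanning_subgraph T G /\ tree T.

End Graphs.

Section FiniteMetricSpaces.
Context {R : realType} (X : finMetricType R).
Implicit Types x y z p : X.

Definition tie_breaking : Prop :=
  forall x x' y y', x != x' -> y != y' -> [set x; x'] != [set y; y'] ->
    mdist x x' != mdist y y'.

Definition fourth_point_condition : Prop :=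
  forall x y z, exists p,
    mdist x p + mdist y p + mdist z p =
      2^-1 * (mdist x y + mdist y z + mdist z x).

Definition walk_length x (s : seq X) : R :=
  \sum_(w <- pairmap (fun y z => mdist y z) x s) w.

Definition non_basic x x' : Prop :=
  exists s : seq X, [/\ (0 < size s)%N, uniq s, x \notin s, x' \notin s &
    mdist x x' = walk_length x (rcons s x')].

Definition complete_edge x x' : bool := x != x'.

Definition basic_edge x x' : bool :=
  complete_edge x x' && ~~ `[< non_basic x x' >].

Lemma complete_edge_sym : symmetric complete_edge.
Proof. by move=> x y; rewrite /complete_edge eq_sym. Qed.

Lemma complete_edge_irrefl : irreflexive complete_edge.
Proof. by move=> x; rewrite /complete_edge eqxx. Qed.

Lemma walk_length_rev x x' (s : seq X) :
  walk_length x (rcons s x') = walk_length x' (rcons (rev s) x).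
Proof.
rewrite /walk_length; elim: s x => [|y s IHs] x.
  by rewrite /= !big_seq1 metric_sym.
rewrite rcons_cons /= big_cons IHs rev_cons -[rcons (rcons _ _) x]cats1.
by rewrite pairmap_cat last_rcons big_cat /= big_seq1 metric_sym addrC.
Qed.

Lemma non_basic_sym x x' : non_basic x x' -> non_basic x' x.
Proof.
case=> s [s_gt0 s_uniq xNs x'Ns sE]; exists (rev s).
by rewrite size_rev rev_uniq !mem_rev -walk_length_rev metric_sym.
Qed.

Lemma basic_edge_sym : symmetric basic_edge.
Proof.
move=> x y; rewrite /basic_edge complete_edge_sym; congr (_ && ~~ _).
by apply/asboolP/asboolP; exact: non_basic_sym.
Qed.

Lemma basic_edge_irrefl : irreflexive basic_edge.
Proof. by move=> x; rewrite /basic_edge complete_edge_irrefl. Qed.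

Definition complete_graph : wgraph R X :=
  WGraph complete_edge_sym complete_edge_irrefl (@metric_sym R X).

Definition basic_geodesic_graph : wgraph R X :=
  WGraph basic_edge_sym basic_edge_irrefl (@metric_sym R X).

Definition spanning_tree_metric_space : Prop :=
  spanning_tree basic_geodesic_graph complete_graph.

End FiniteMetricSpaces.

(* Main.v *)
(** Only the case k = 1 of non-basic edges matters: an edge is basic when no
third point lies between its ends. The fourth point of x, y, z is then a point
lying between any two of them.

If the graph is acyclic, let p be a point between x and y and between x and z
at maximal distance from x. By maximality the first edges pq and pq' of
geodesics towards y and z differ. Were p not between y and z, then q, y, z, q'
would be connected in the graph without p, closing a cycle through p.

Conversely, on a cycle let v be a vertex farthest from some vertex z, with
neighbours u and u'. Then u and u' both lie between z and v, and v lies between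
u and u'. Hence the fourth point m of z, u, u' satisfies d(m, u) = d(u', v):
u, v, u', m form a parallelogram, against the tie-breaking rule. *)
Require Import Defs.
From mathcomp Require Import all_boot all_order all_algebra.
From mathcomp Require Import boolp filter reals topology.
From mathcomp Require Import lra.

Set Implicit Arguments.
Unset Strict Implicit.
Unset Printing Implicit Defensive.

Import Order.TTheory GRing.Theory Num.Theory.

Local Open Scope ring_scope.

Section Betweenness.
Context {R : realType} {X : finMetricType R}.
Implicit Types (x y z p q w : X) (s : seq X).

Definition between x p y : bool := mdist x y == mdist x p + mdist p y.

Lemma between_sym x p y : between x p y = between y p x.
Proof.
by rewrite /between (metric_sym x y) (metric_sym x p) (metric_sym p y) addrC.
Qed.

Lemma betweenl x y : between x x y.
Proof. by rewrite /between mdistxx add0r. Qed.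

Lemma betweenr x y : between x y y.
Proof. by rewrite between_sym betweenl. Qed.

Lemma between_transr x p q y :
  between x p y -> between p q y -> between x p q && between x q y.
Proof.
rewrite /between => /eqP xpy /eqP pqy.
have := metric_triangle x p q; have := metric_triangle x q y => h1 h2.
by apply/andP; split; apply/eqP; lra.
Qed.

Lemma between_transl x q p y :
  between x p y -> between x q p -> between q p y && between x q y.
Proof.
rewrite ![between x _ _]between_sym [between q p y]between_sym.
exact: between_transr.
Qed.

Lemma between_antisym x p q : between x p q -> between p x q -> p = x.
Proof.
rewrite /between (metric_sym p x) => /eqP xpq /eqP pxq.
by apply/esym/mdist_positivity; lra.
Qed.

Lemma mdist_le_walk x s : mdist x (last x s) <= walk_length x s.
Proof.
rewrite /walk_length; elim: s x => [|y s IHs] x /=.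
  by rewrite mdistxx big_nil.
by rewrite big_cons (le_trans (metric_triangle x y _)) // lerD2l.
Qed.

(** Take the first point [p] of the chain: the rest of the chain is no shorter than [mdist p y], so
    the triangle inequality through [p] is an equality. *)
Lemma non_basicP x y :
  non_basic x y <-> exists p, [/\ p != x, p != y & between x p y].
Proof.
split=> [[[|p s] [//= _ _ xNs yNs xy]]|[p [px py xpy]]].
  exists p; move: xNs yNs; rewrite !inE !negb_or eq_sym => /andP[-> _].
  rewrite eq_sym => /andP[-> _]; split=> //.
  have := metric_triangle x p y; have := mdist_le_walk p (rcons s y).
  move: xy; rewrite last_rcons /walk_length /= big_cons => xy h1 h2.
  by apply/eqP; lra.
exists [:: p]; rewrite !inE (eq_sym x) (eq_sym y); split=> //.
by rewrite /walk_length /= big_cons big_seq1; exact/eqP.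
Qed.

Lemma basic_edge_neq x y : basic_edge x y -> x != y.
Proof. by case/andP. Qed.

Lemma basic_edge_between x p y :
  basic_edge x y -> between x p y -> (p == x) || (p == y).
Proof.
move=> /andP[_ /asboolPn xy] xpy; apply/norP => -[px py].
by apply: xy; apply/non_basicP; exists p.
Qed.

(** Induction on the number of points between [x] and [y]. A non-basic pair splits at some [p]; each
    half contains only points between [x] and [y] and loses the opposite end, so both counts
    drop. *)
Lemma geodesic_ind (P : X -> X -> Prop) :
  (forall x, P x x) -> (forall x y, basic_edge x y -> P x y) ->
  (forall x p y, p != x -> between x p y -> P x p -> P p y -> P x y) ->
  forall x y, P x y.
Proof.
move=> Prefl Pedge Pcat x y.
have [n] := ubnP #|[pred p | between x p y]|; elim: n x y => // n IHn x y.
rewrite ltnS => le_n; case: (eqVneq x y) => [->//|xy].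
case: (boolP (basic_edge x y)) => [/Pedge//|].
rewrite /basic_edge /complete_edge xy /= negbK.
move=> /asboolP/non_basicP[p [px py xpy]].
apply: (Pcat x p y) => //; apply/IHn/(leq_trans _ le_n)/proper_card/properP.
- split; first by apply/fintype.subsetP => q; rewrite !inE =>
    /(between_transl xpy)/andP[].
  exists y; rewrite !inE ?betweenr //; apply/negP; rewrite between_sym => ypx.
  by case/eqP: py; apply: between_antisym ypx; rewrite between_sym.
- split; first by apply/fintype.subsetP => q; rewrite !inE =>
    /(between_transr xpy)/andP[].
  exists x; rewrite !inE ?betweenl //; apply/negP => pxy.
  by case/eqP: px; exact: between_antisym xpy pxy.
Qed.

Lemma connected_basic_geodesic_graph :
  connected_graph (basic_geodesic_graph X).
Proof.
apply: geodesic_ind => [x|x y xy|x p y _ _]; first exact: connect0.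
  exact: connect1.
exact: connect_trans.
Qed.

Lemma first_basic_edge x y :
  x != y -> exists2 q, basic_edge x q & between x q y.
Proof.
move: x y; apply: geodesic_ind => [x|x y xy _|x p y px xpy IH _ _].
- by rewrite eqxx.
- by exists y; rewrite ?betweenr.
- rewrite eq_sym in px; have [q xq xqp] := IH px; exists q => //.
  by case/andP: (between_transl xpy xqp).
Qed.

Definition basic_edge_off p : rel X :=
  [rel x y | [&& basic_edge x y, x != p & y != p]].

Lemma basic_edge_off_sym p : symmetric (basic_edge_off p).
Proof.
by move=> x y; rewrite /basic_edge_off /= basic_edge_sym [(x != p) && _]andbC.
Qed.

(** A geodesic visits only points between its ends, hence avoids [p]. *)
Lemma connect_basic_edge_off p x y :
  ~~ between x p y -> connect (basic_edge_off p) x y.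
Proof.
move: x y; apply: geodesic_ind => [x|x y xy|x w y _ xwy IHx IHy] xpy.
- exact: connect0.
- apply: connect1; rewrite /basic_edge_off /= xy /=.
  by apply/andP; split; apply: contraNneq xpy => ->; rewrite ?betweenl ?betweenr.
- apply: (connect_trans (IHx _) (IHy _)); apply: contraNN xpy.
    by case/(between_transl xwy)/andP.
  by case/(between_transr xwy)/andP.
Qed.

Lemma path_basic_edge_off p x s :
  x != p -> path (basic_edge_off p) x s ->
  path (@basic_edge R X) x s && (p \notin x :: s).
Proof.
rewrite inE negb_or (eq_sym p) => ->; elim: s x => //= y s IHs x.
by case/andP=> /and3P[-> _ yp] /IHs; rewrite inE negb_or (eq_sym p) yp.
Qed.

Lemma acyclic_connect_off p q q' :
  acyclic_graph (basic_geodesic_graph X) ->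
  basic_edge p q -> basic_edge p q' -> connect (basic_edge_off p) q q' -> q = q'.
Proof.
move=> acyc pq pq' /connectP[s0 s0_path lasts0].
have qp : q != p by rewrite eq_sym basic_edge_neq.
case/shortenP: s0_path lasts0 => s qs uniq_qs _ q'E.
have /andP[qs_path pNqs] := path_basic_edge_off qp qs.
(* An empty path gives [q = q']; a nonempty simple one closes up through [p] to a cycle on at least
   three vertices. *)
case: s => [|r s] in qs uniq_qs q'E qs_path pNqs *; first by rewrite q'E.
case: (acyc [:: p, q, r & s]) => //.
rewrite /ucycle cons_uniq pNqs uniq_qs andbT /cycle rcons_path.
move: qs_path; rewrite /= pq => -> /=; rewrite andbT.
by rewrite -[last r s]/(last q (r :: s)) -q'E basic_edge_sym.
Qed.

Lemma acyclic_median x y z :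
  acyclic_graph (basic_geodesic_graph X) ->
  exists p, [/\ between x p y, between x p z & between y p z].
Proof.
move=> acyc.
have Px : between x x y && between x x z by rewrite !betweenl.
case: (@arg_maxP _ R X x (fun p => between x p y && between x p z)
  (fun p => mdist x p) Px) => p /andP[xpy xpz] p_max.
exists p; split=> //; apply/negPn/negP => ypz.
have py : p != y by apply: contraNneq ypz => ->; rewrite betweenl.
have pz : p != z by apply: contraNneq ypz => ->; rewrite betweenr.
have [q pq pqy] := first_basic_edge py; have [q' pq' pq'z] := first_basic_edge pz.
(* By antisymmetry [p] is not between [u] and [v], so a geodesic joining them misses [p]. *)
have off u v : basic_edge p u -> between p u v -> connect (basic_edge_off p) u v.
  move=> /basic_edge_neq/eqP pu puv; apply/connect_basic_edge_off/negP => upv.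
  by case: pu; exact: between_antisym upv puv.
have qq' : q = q'.
  apply: (acyclic_connect_off acyc pq pq').
  apply: connect_trans (off _ _ pq pqy) _.
  apply: connect_trans (connect_basic_edge_off ypz) _.
  by rewrite (sym_connect_sym (basic_edge_off_sym p)) off.
(* The common neighbour [q] is still between [x] and both [y] and [z], but farther from [x] than
   [p]. *)
rewrite -{q'}qq' in pq' pq'z.
have /andP[xpq xqy] := between_transr xpy pqy.
have /andP[_ xqz] := between_transr xpz pq'z.
have := p_max q; rewrite xqy xqz => /(_ isT); apply/negP; rewrite -ltNge.
by rewrite (eqP xpq) ltrDl mdist_gt0 basic_edge_neq.
Qed.

(** Half the sum of the three triangle inequalities through [p] bounds the left side from below;
    equality in the sum forces equality in each. *)
Lemma fourth_pointP x y z p :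
  mdist x p + mdist y p + mdist z p =
    2^-1 * (mdist x y + mdist y z + mdist z x) <->
  [/\ between x p y, between x p z & between y p z].
Proof.
have := metric_triangle x p y; have := metric_triangle x p z.
have := metric_triangle y p z; rewrite /between (metric_sym z x).
rewrite (metric_sym p y) (metric_sym p z) => yz xz xy.
split=> [E|[/eqP ? /eqP ? /eqP ?]]; last by lra.
by split; apply/eqP; lra.
Qed.

(** The fourth point of [z], [u], [v] lies between [u] and [v], hence is one of them. *)
Lemma fourth_point_edge z u v :
  fourth_point_condition X -> basic_edge u v -> between z u v || between z v u.
Proof.
move=> /(_ z u v)[p /fourth_pointP[zpu zpv upv]] uv.
by case/orP: (basic_edge_between uv upv) => /eqP <-; rewrite ?zpv ?zpu ?orbT.
Qed.

(** The fourth point of [u], [u'], [v] is an end of both edges, and their only common end is [v]. *)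
Lemma fourth_point_path u v u' :
  fourth_point_condition X -> basic_edge u v -> basic_edge u' v -> u != u' ->
  between u v u'.
Proof.
move=> /(_ u u' v)[p /fourth_pointP[upu' upv u'pv]] uv u'v uu'.
case/orP: (basic_edge_between uv upv) => /eqP pE; last by rewrite -pE.
case/orP: (basic_edge_between u'v u'pv) => /eqP pE'; last by rewrite -pE'.
by case/eqP: uu'; rewrite -pE.
Qed.

Lemma fourth_point_acyclic :
  tie_breaking X -> fourth_point_condition X ->
  acyclic_graph (basic_geodesic_graph X).
Proof.
move=> tie fourth [//|z c] c_gt2 c_cycle; set C := z :: c in c_gt2 c_cycle.
have zC : z \in C by rewrite inE eqxx.
case: (@arg_maxP _ R X z (mem C) (fun v => mdist z v) zC) => v vC v_max.
(* Once the cycle starts at [v], its neighbours [u] and [u'] are the first and last remaining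
   vertices; the length bound keeps them distinct. *)
have [i s rotE] := rot_to vC.
have: ucycle (@basic_edge R X) (v :: s) by rewrite -rotE rot_ucycle.
have: (2 < size (v :: s))%N by rewrite -rotE size_rot.
have sC w : w \in s -> w \in C.
  by move=> ws; rewrite -(mem_rot i) rotE inE ws orbT.
case: s {rotE} sC => [//|u s] sC; case/lastP: s sC => [//|s u'] sC _.
rewrite /ucycle /= rcons_path last_rcons !(inE, mem_rcons) !negb_or.
case/andP=> /and3P[vu _ u'v] /and3P[_ /andP[uu' _] _].
have uC : u \in C by apply: sC; rewrite inE eqxx.
have {sC} u'C : u' \in C by apply: sC; rewrite inE mem_rcons inE eqxx orbT.
have uv : basic_edge u v by rewrite basic_edge_sym.
have nearer w : w \in C -> basic_edge w v -> between z w v.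
  move=> wC wv; case/orP: (fourth_point_edge z fourth wv) => // zvw.
  have : mdist z w <= mdist z v := v_max w wC.
  by rewrite leNgt (eqP zvw) ltrDl mdist_gt0 eq_sym (basic_edge_neq wv).
have zuv := eqP (nearer u uC uv); have zu'v := eqP (nearer u' u'C u'v).
have uvu' := eqP (fourth_point_path fourth uv u'v uu').
have [m /fourth_pointP[/eqP zmu /eqP zmu' /eqP umu']] := fourth z u u'.
(* The two routes from [z] to [v] through [m] give [mdist m u + mdist u v = mdist m u' + mdist u'
   v]; add [mdist u m + mdist m u' = mdist u v + mdist v u']. *)
have mu : mdist m u = mdist u' v.
  by move: uvu'; rewrite umu' (metric_sym u m) (metric_sym v u'); lra.
have u'v_neq := basic_edge_neq u'v.
have mu_neq : m != u by rewrite -mdist_gt0 mu mdist_gt0.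
have sets_neq : [set m; u] != [set u'; v].
  apply/eqP => /setP/(_ u); rewrite !inE eqxx orbT => /esym/orP[].
    by apply/negP.
  by apply/negP; exact: basic_edge_neq.
by have := tie _ _ _ _ mu_neq u'v_neq sets_neq; rewrite mu eqxx.
Qed.

End Betweenness.

Theorem theorem3p1 (R : realType) (X : finMetricType R) :
  tie_breaking X ->
  (spanning_tree_metric_space X <-> fourth_point_condition X).
Proof.
move=> tie; split=> [[_ [_ acyc]] x y z|fourth].
  by have [p pP] := acyclic_median x y z acyc; exists p; apply/fourth_pointP.
split=> [x y /andP[]//|]; split; first exact: connected_basic_geodesic_graph.
exact: fourth_point_acyclic.
Qed.
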